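(* Let $X$ be a totally disconnected, compact, metrizable topological space. Let $\mathcal{G}\subset\mathrm{Homeo}(X)$ be an ample group that has no finite orbits. Suppose $Y$ is a finite nonempty subset of $X$. Then the stabilizer $\mathrm{St}_{\mathcal{G}}(Y)$ is a maximal subgroup of $\mathcal{G}$ if and only if $Y$ is contained in a single orbit of $\mathcal{G}$.
   Context: $\mathrm{Homeo}(X)$ is the group of all homeomorphisms of $X$. For a group $G\subset\mathrm{Homeo}(X)$, its full amplification $\mathsf{F}(G)$ is the group of all homeomorphisms $f$ of $X$ such that every point $x\in X$ has an open neighborhood $U_x$ on which $f$ coincides with some element of $G$. The group $G$ is called ample if $\mathsf{F}(G)=G$. Orbits are the sets $\{g(x)\mid g\in\mathcal{G}\}$, $x\in X$. For $Y\subset X$, $\mathrm{St}_{\mathcal{G}}(Y)=\{g\in\mathcal{G}\mid g(Y)=Y\}$ (set stabilizer). A maximal subgroup of $\mathcal{G}$ is a proper subgroup $H$ such that there is no subgroup $K$ with $H\subsetneq K\subsetneq\mathcal{G}$. *)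

(* Defs.v *)
From HB Require Import structures.
From mathcomp Require Import all_boot all_order all_algebra.
From mathcomp Require Import all_classical all_reals topology.

Set Implicit Arguments.
Unset Strict Implicit.
Unset Printing Implicit Defensive.

Import Order.TTheory GRing.Theory Num.Theory.

Local Open Scope classical_set_scope.

Definition metrizable (R : realType) (X : topologicalType) : Prop :=
  exists d : X -> X -> R,
    [/\ forall x y, (0 <= d x y)%R,
        forall x y, d x y = 0%R <-> x = y,
        forall x y, d x y = d y x,
        forall x y z, (d x z <= d x y + d y z)%R
      & forall x (A : set X),
          nbhs x A <-> exists2 e : R, (0 < e)%R & [set y | (d x y < e)%R] `<=` A].

(* The inverse is stored as data; since it is determined by the underlying
   function, homeomorphisms are equal as soon as they agree pointwise (homeoP). *)
Record homeo (X : topologicalType) := Homeo {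
  homeo_fun :> X -> X;
  homeo_inv : X -> X;
  homeo_funK : cancel homeo_fun homeo_inv;
  homeo_invK : cancel homeo_inv homeo_fun;
  homeo_continuous : continuous homeo_fun;
  homeo_inv_continuous : continuous homeo_inv
}.

Section HomeoGroup.
Variable X : topologicalType.
Implicit Types f g h : homeo X.

Lemma homeoP f g : f =1 g -> f = g.
Proof.
case: f g => [f f' fK f'K cf cf'] [g g' gK g'K cg cg'] /= /funext fg.
case: g / fg gK g'K cg => gK g'K cg.
have f'g' : f' = g' by apply/funext => x; rewrite -{1}(g'K x) fK.
case: g' / f'g' gK g'K cg' => gK g'K cg'.
by congr Homeo; exact: Prop_irrelevance.
Qed.

HB.instance Definition _ := gen_eqMixin (homeo X).
HB.instance Definition _ := gen_choiceMixin (homeo X).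

Definition homeo_id : homeo X :=
  @Homeo X id id (fun=> erefl) (fun=> erefl)
    (fun x => @cvg_id X (nbhs x)) (fun x => @cvg_id X (nbhs x)).

Definition homeo_sym f : homeo X :=
  Homeo (@homeo_invK _ f) (@homeo_funK _ f)
    (@homeo_inv_continuous _ f) (@homeo_continuous _ f).

Lemma homeo_comp_continuous f g : continuous (f \o g).
Proof. by move=> x; apply: continuous_comp; exact: homeo_continuous. Qed.

Definition homeo_comp f g : homeo X :=
  @Homeo X (f \o g) (homeo_sym g \o homeo_sym f)
    (can_comp (@homeo_funK _ f) (@homeo_funK _ g))
    (can_comp (@homeo_invK _ g) (@homeo_invK _ f))
    (@homeo_comp_continuous f g)
    (@homeo_comp_continuous (homeo_sym g) (homeo_sym f)).

Lemma homeo_compA : associative homeo_comp.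
Proof. by move=> f g h; exact: homeoP. Qed.

Lemma homeo_comp1f : left_id homeo_id homeo_comp.
Proof. by move=> f; exact: homeoP. Qed.

Lemma homeo_compf1 : right_id homeo_id homeo_comp.
Proof. by move=> f; exact: homeoP. Qed.

Lemma homeo_compVf : left_inverse homeo_id homeo_sym homeo_comp.
Proof. by move=> f; apply: homeoP => x /=; exact: homeo_funK. Qed.

Lemma homeo_compfV : right_inverse homeo_id homeo_sym homeo_comp.
Proof. by move=> f; apply: homeoP => x /=; exact: homeo_invK. Qed.

HB.instance Definition _ := isGroup.Build (homeo X)
  homeo_compA homeo_comp1f homeo_compf1 homeo_compVf homeo_compfV.

End HomeoGroup.

Definition is_subgroup (T : groupType) (H : set T) : Prop :=
  group_closed [in H].

Definition maximal_subgroup (T : groupType) (G H : set T) : Prop :=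
  [/\ is_subgroup H, H `<` G &
      ~ exists K : set T, [/\ is_subgroup K, H `<` K & K `<` G]].

Section Amplification.
Variable X : topologicalType.
Implicit Types (G : set (homeo X)) (Y : set X).

Definition full_amplification G : set (homeo X) :=
  [set f | forall x : X, exists U : set X,
     [/\ open U, U x & exists2 g, G g & forall y, U y -> f y = g y]].

Definition ample G : Prop := full_amplification G = G.

Definition homeo_orbit G (x : X) : set X := [set g x | g in G].

Definition set_stabilizer G Y : set (homeo X) :=
  [set g | G g /\ g @` Y = Y].

End Amplification.

(* Main.v *)
Require Import Defs.
From mathcomp Require Import all_boot all_order all_algebra.
From mathcomp Require Import all_classical all_reals topology.

Import Order.TTheory GRing.Theory Num.Theory.

Local Open Scope classical_set_scope.

(** In a compact Hausdorff space quasicomponents are connected, so [X] has a basis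
    of clopen sets.  Hence ampleness provides, for [c = g x] with [g]
    in [G], an involution in [G] that swaps [x] and [c] and fixes any given finite
    set of further points: glue [g] on a small clopen neighbourhood [U] of [x],
    [g^-1] on [g U], and the identity elsewhere.

    If [Y] meets several orbits and [O] is one of them, then [St(Y)] is properly
    contained in [St(Y `&` O)], which is proper.  If [Y] lies in one orbit, take
    [h] in an overgroup [K] of [St(Y)] with [h y] outside [Y].  A swap [s] of
    [h y] with a point outside [Y] and [h Y] lies in [St(Y)], and [h^-1 s h]
    moves [y] out of [Y] while fixing the rest of [Y].  Conjugating by [St(Y)],
    [K] contains every element of [G] that moves just one point of [Y], out of
    [Y]; composing [g] in [G] with such swaps brings [g Y] back to [Y], one point
    at a time. *)

(** The balls of radius [e / 2] around two inseparable points meet, so the points are at distance at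
    most [e], for every positive [e]. *)
Lemma metrizable_hausdorff (R : realType) (X : topologicalType) :
  metrizable R X -> hausdorff_space X.
Proof.
move=> [d [d_ge0 d_eq0 d_sym d_tri nbhs_d]] x y xy.
apply/d_eq0; apply/eqP; rewrite eq_le d_ge0 andbT; apply/ler_addgt0Pl => e e0.
have e20 : (0 < e / 2)%R by rewrite divr_gt0.
have ball_nbhs z : nbhs z [set w | (d z w < e / 2)%R] by apply/nbhs_d; exists (e / 2)%R.
have [z [/= xz yz]] := xy _ _ (ball_nbhs x) (ball_nbhs y).
rewrite addr0 (le_trans (d_tri x z y))// [leRHS]splitr ltW// ltrD// d_sym//.
Qed.

(** * Quasicomponents and clopen bases *)

Section Quasicomponent.
Variable X : topologicalType.
Hypotheses (X_compact : compact [set: X]) (X_hausdorff : hausdorff_space X).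

Definition quasicomponent (x : X) : set X := \bigcap_(U in [set U | clopen U /\ U x]) U.

(** By compactness: if no such [U] existed, the sets [U] minus [W], for [U] clopen around [x], would
    generate a proper filter. Its cluster point would lie in the quasicomponent but outside [W]. *)
Lemma clopen_sub_open (x : X) (W : set X) :
  open W -> quasicomponent x `<=` W ->
  exists U, [/\ clopen U, U x & U `<=` W].
Proof.
move=> oW QW; apply: contrapT => noU.
pose F := filter_from [set U : set X | clopen U /\ U x] (fun U => U `&` ~` W).
have FF : ProperFilter F.
  apply: filter_from_proper; last first.
    move=> U [cU Ux]; apply: contrapT => UW0; apply: noU; exists U; split=> //.
    by move=> y Uy; apply: contrapT => Wy; apply: UW0; exists y.
  apply: filter_from_filter; first by exists setT; split=> //; exact: clopenT.
  move=> U V [cU Ux] [cV Vx]; exists (U `&` V); first by split=> //; exact: clopenI.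
  by move=> y [[Uy Vy] Wy].
have [p [_ Fp]] := X_compact _ FF filterT.
have Fcl U : clopen U -> U x -> closure (U `&` ~` W) p.
  by move=> cU Ux; move=> B Bp; apply: Fp => //; exists U.
have := Fcl _ clopenT I; rewrite setTI -(closure_id _).1; last exact: open_closedC.
apply; apply: QW => U [cU Ux].
by have [_ /closure_id ->] := cU; apply: closureS (Fcl _ cU Ux); exact: subIsetl.
Qed.

Lemma quasicomponent_connected (x : X) : connected (quasicomponent x).
Proof.
set Q := quasicomponent x.
have cQ : closed Q by apply: closed_bigI => U [[]].
have Qx : Q x by move=> U [].
(* If [Q] splits into closed [B] and [C], a clopen set trapped in disjoint
   neighbourhoods of them meets the one of [B] in a clopen set. *)
have trap (B C : set X) : closed B -> closed C -> B x ->
    Q `<=` B `|` C -> B `&` C = set0 -> Q `&` C = set0.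
  move=> cB cC Bx QBC BC0.
  have [|V BV VC] := @compact_normal _ X_hausdorff X_compact B cB (~` C).
    move=> b Bb; apply: open_nbhs_nbhs; split; first exact: closed_openC.
    by move=> Cb; rewrite -[False]/(set0 b) -BC0.
  have [||U [[oU cU] Ux UV]] := @clopen_sub_open x (V^° `|` ~` closure V).
  - apply: openU; first exact: open_interior.
    by apply: closed_openC; exact: closed_closure.
  - move=> y /QBC [/BV ?|Cy]; [by left|right => /VC; exact].
  (* [U] avoids the boundary of [V], so its trace on [V] is both open and closed. *)
  have UVE : U `&` V^° = U `&` closure V.
    apply/seteqP; split=> y [Uy Vy]; split=> //.
      by apply: subset_closure; exact: interior_subset.
    by case: (UV y Uy).
  rewrite -subset0 => y [Qy Cy].
  have /Qy[_ /interior_subset/subset_closure/VC] : clopen (U `&` V^°) /\ (U `&` V^°) x.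
    do 2!split=> //; last exact: BV.
    - by apply: openI => //; exact: open_interior.
    - by rewrite UVE; apply: closedI => //; exact: closed_closure.
  exact.
move=> B [b Bb] [C oC BC] [D cD BD].
have cB : closed B by rewrite BD; exact: closedI.
have cB' : closed (Q `&` ~` C) by apply: closedI => //; exact: open_closedC.
have QB : Q `<=` B `|` (Q `&` ~` C).
  by move=> y Qy; have [Cy|Cy] := pselect (C y); [left; rewrite BC|right].
have BB' : B `&` (Q `&` ~` C) = set0.
  by rewrite BC -subset0 => y [[_ Cy] [_]].
(* Whichever piece contains [x], [trap] empties the other one. *)
have [Bx|B'x] := QB _ Qx.
  have QC0 := trap _ _ cB cB' Bx QB BB'.
  apply/seteqP; split=> [y|y Qy]; first by rewrite BC => -[].
  by case: (QB y Qy) => // QCy; suff : set0 y by []; rewrite -QC0.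
have QB0 : Q `&` B = set0 by apply: (trap _ _ cB' cB); rewrite 1?setUC // setIC.
suff : set0 b by [].
by rewrite -QB0; split=> //; move: Bb; rewrite BC => -[].
Qed.

Lemma totally_disconnected_clopen_basis (x : X) (W : set X) :
  totally_disconnected [set: X] -> nbhs x W ->
  exists U, [/\ clopen U, U x & U `<=` W].
Proof.
move=> tdX; rewrite nbhsE => -[V [oV Vx] VW].
have [y Qy|U [cU Ux UV]] := @clopen_sub_open x V oV; last first.
  by exists U; split=> //; exact: subset_trans VW.
suff -> : y = x by [].
rewrite -[_ = _]/([set x] y) -tdX//; exists (quasicomponent x) => //; split=> //.
  by move=> U [].
exact: quasicomponent_connected.
Qed.

End Quasicomponent.

Lemma is_subgroup1 (T : groupType) (H : set T) : is_subgroup H -> H 1%g.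
Proof. by move=> [/set_mem]. Qed.

Lemma is_subgroupV (T : groupType) (H : set T) (g : T) :
  is_subgroup H -> H g -> H g^-1%g.
Proof. by move=> /group_closedV HV /mem_set/HV/set_mem. Qed.

Lemma is_subgroupM (T : groupType) (H : set T) (g h : T) :
  is_subgroup H -> H g -> H h -> H (g * h)%g.
Proof. by move=> /group_closedM HM /mem_set Hg /mem_set Hh; exact/set_mem/HM. Qed.

Lemma homeoK (X : topologicalType) (g : homeo X) (z : X) : (g^-1)%g (g z) = z.
Proof. exact: homeo_funK. Qed.

Lemma homeoKV (X : topologicalType) (g : homeo X) (z : X) : g ((g^-1)%g z) = z.
Proof. exact: homeo_invK. Qed.

(** * Involutions in ample groups *)

Section AmpleGroup.
Variables (X : topologicalType) (G : set (homeo X)).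
Hypotheses (G_group : is_subgroup G) (G_ample : ample G).
Hypothesis X_hausdorff : hausdorff_space X.
Hypothesis clopen_basis : forall (x : X) (W : set X),
  nbhs x W -> exists U, [/\ clopen U, U x & U `<=` W].

(** Agreeing locally with elements of [G] makes [f] continuous; being its own inverse, it is then a
    homeomorphism. *)
Lemma ample_involution (f : X -> X) : involutive f ->
  (forall x, exists U : set X,
     [/\ open U, U x & exists2 g, G g & forall y, U y -> f y = g y]) ->
  exists2 s, G s & s =1 f.
Proof.
move=> fK Gf; have cf : continuous f.
  move=> x; have [U [oU Ux [g _ fg]]] := Gf x.
  apply: (cvg_trans (G := g @ x)); last by rewrite (fg x Ux); exact: homeo_continuous.
  apply: near_eq_cvg; near=> y; rewrite fg//; near: y.
  exact: open_nbhs_nbhs.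
exists (Homeo fK fK cf cf) => //.
by rewrite -G_ample; exact: Gf.
Unshelve. all: by end_near. Qed.

Lemma ample_swap (x c : X) (F : set X) : finite_set F ->
  homeo_orbit G x c ->
  exists s, [/\ G s, s x = c, s c = x &
    forall z, F z -> z <> x -> z <> c -> s z = z].
Proof.
move=> finF [g Gg gx]; have [<-|/eqP xc] := eqVneq x c.
  by exists 1%g; split=> //; exact: is_subgroup1.
have := X_hausdorff; rewrite open_hausdorff => /(_ x c).
case=> [|[A B]]; first exact/eqP.
rewrite !inE /= => -[Ax Bc] [oA oB /eqP AB0].
(* This allows [U] to meet [F] at most in [x], and its image under [g] to meet [F] at most in
   [c]. *)
have Fnbhs (a : X) : nbhs a (~` (F `\ a)).
  apply: open_nbhs_nbhs; split; last by move=> [_ /(_ erefl)].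
  apply: closed_openC; apply: compact_closed => //; apply: finite_compact.
  exact: finite_setD.
have gnbhs (V : set X) : nbhs c V -> nbhs x (g @^-1` V).
  by rewrite -gx; exact: homeo_continuous.
have [] := @clopen_basis x
   ((A `&` ~` (F `\ x)) `&` g @^-1` (B `&` ~` (F `\ c))).
  apply: filterI; first by apply: filterI => //; exact: open_nbhs_nbhs.
  by apply: gnbhs; apply: filterI => //; exact: open_nbhs_nbhs.
move=> U [[oU cU] Ux UAB].
pose V := (g^-1)%g @^-1` U.
have oV : open V by apply: open_comp => // ? _; exact: homeo_continuous.
have cV : closed V by apply: closed_comp => // ? _; exact: homeo_continuous.
(* [V] is the image of [U] under [g]; it lies in [B] while [U] lies in [A], so the two pieces of [f]
   do not overlap. *)
have UV z : U z -> ~ V z.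
  move=> /UAB[[Az _] _] /UAB[_ []]; rewrite /= homeoKV => Bz _.
  by move: AB0 => /eqP/seteqP[/(_ z)] [].
have gU z : U z -> V (g z) by move=> Uz; rewrite /V /preimage /mkset homeoK.
pose f z := if z \in U then g z else if z \in V then (g^-1)%g z else z.
have fU z : U z -> f z = g z by move=> ?; rewrite /f mem_set.
have fV z : V z -> f z = (g^-1)%g z.
  by move=> Vz; rewrite /f memNset ?mem_set// => /UV.
have fid z : ~ U z -> ~ V z -> f z = z by move=> ? ?; rewrite /f !memNset.
have [||s Gs sf] := ample_involution f.
- move=> z; have [Uz|Uz] := pselect (U z).
    by rewrite (fU _ Uz) fV ?homeoK//; exact: gU.
  have [Vz|Vz] := pselect (V z); last by rewrite fid fid.
  by rewrite (fV _ Vz) fU ?homeoKV.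
- move=> z; have [Uz|Uz] := pselect (U z); first by exists U; split=> //; exists g.
  have [Vz|Vz] := pselect (V z).
    by exists V; split=> //; exists (g^-1)%g => //; exact: is_subgroupV.
  exists (~` U `&` ~` V); split=> //; first by apply: openI; exact: closed_openC.
  by exists 1%g; [exact: is_subgroup1|move=> y [? ?]; exact: fid].
exists s; split=> //; rewrite ?sf.
- by rewrite fU.
- by rewrite -gx fV ?homeoK//; exact: gU.
move=> z Fz zx zc; rewrite sf fid//.
  by move=> /UAB[[_ []]].
by move=> /UAB[_ [_ []]]; rewrite /= homeoKV.
Qed.

End AmpleGroup.

Lemma image_fixed (T : Type) (f : T -> T) (A : set T) :
  (forall x, A x -> f x = x) -> f @` A = A.
Proof.
move=> fid; apply/seteqP; split=> [_ [x Ax <-]|x Ax]; first by rewrite fid.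
by exists x => //; exact: fid.
Qed.

(** * Orbits and set stabilizers *)

Section Stabilizers.
Variables (X : topologicalType) (G : set (homeo X)).
Hypothesis G_group : is_subgroup G.

Lemma homeo_orbit_trans (x y z : X) :
  homeo_orbit G x y -> homeo_orbit G y z -> homeo_orbit G x z.
Proof. by move=> [g Gg <-] [h Gh <-]; exists (h * g)%g => //; exact: is_subgroupM. Qed.

Lemma homeo_orbit_sym (x y : X) : homeo_orbit G x y -> homeo_orbit G y x.
Proof. by move=> [g Gg <-]; exists (g^-1)%g; [exact: is_subgroupV|exact: homeoK]. Qed.

Lemma is_subgroup_set_stabilizer (Y : set X) : is_subgroup (set_stabilizer G Y).
Proof.
split.
  by apply/mem_set; split; [exact: is_subgroup1|exact: image_id].
move=> g h /set_mem[Gg gY] /set_mem[Gh hY]; apply/mem_set; split.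
  by apply: is_subgroupM => //; exact: is_subgroupV.
have hVY : (h^-1)%g @` Y = Y.
  by rewrite -{1}hY image_comp; apply: image_fixed => y _; exact: homeoK.
by rewrite -[RHS]gY -{2}hVY image_comp.
Qed.

(** An injective self-map of a finite set is onto, so mapping the set into itself suffices. *)
Lemma finite_set_stabilizer (s : seq X) (g : homeo X) : G g ->
  (forall y, y \in s -> g y \in s) -> set_stabilizer G [set` s] g.
Proof.
move=> Gg gs; split=> //; apply/seteqP; split=> [_ [y /= ys <-]|z /= zs].
  exact: gs.
have g_inj : injective g by apply: can_inj (homeo_funK g).
have [] := @uniq_min_size _ (map g (undup s)) (undup s).
- by rewrite map_inj_uniq// undup_uniq.
- by move=> _ /mapP[y + ->]; rewrite !mem_undup; exact: gs.
- by rewrite size_map.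
move=> _ /(_ z); rewrite mem_undup zs => /mapP[y].
by rewrite mem_undup => ys ->; exists y.
Qed.

End Stabilizers.

(** * Maximality, from infinite orbits and swaps alone *)

Section Maximality.
Variables (X : topologicalType) (G : set (homeo X)).
Hypotheses (G_group : is_subgroup G).
Hypothesis G_orbits : forall x : X, infinite_set (homeo_orbit G x).
Hypothesis G_swap : forall (x c : X) (F : set X), finite_set F ->
  homeo_orbit G x c ->
  exists s, [/\ G s, s x = c, s c = x &
    forall z, F z -> z <> x -> z <> c -> s z = z].

Lemma orbit_avoid (x : X) (F : set X) : finite_set F ->
  exists2 c, homeo_orbit G x c & ~ F c.
Proof.
move=> finF; apply: contrapT => noc; apply: (G_orbits x).
by apply: sub_finite_set finF => c xc; apply: contrapT => Fc; apply: noc; exists c.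
Qed.

Section Overgroup.
Variables (s : seq X) (K : set (homeo X)).
Hypothesis s_orbit : forall x y, x \in s -> y \in s -> homeo_orbit G x y.
Hypothesis K_group : is_subgroup K.
Hypothesis HK : set_stabilizer G [set` s] `<` K.
Hypothesis KG : K `<=` G.

(* Commute an element of [K] that moves [Y] with a swap that fixes [Y]. *)
Lemma overgroup_moves_one_point : exists t y, [/\ K t, y \in s, t y \notin s &
  forall w, w \in s -> w != y -> t w = w].
Proof.
have [HsubK] := HK; rewrite -existsNP => -[h /not_implyP[Kh Hh]].
have [y ys hys] : exists2 y, y \in s & h y \notin s.
  apply: contrapT => noy; apply: Hh; apply: finite_set_stabilizer; first exact: KG.
  by move=> y ys; apply/negPn/negP => hys; apply: noy; exists y.
(* Taking [c] outside both [Y] and its image under [h] makes the swap fix [Y] pointwise, move only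
   [h y] in that image, and send it to a point that [h^-1] keeps outside [Y]. *)
pose F : set X := [set` s ++ map h s].
have finF : finite_set F by exact: finite_seq.
have [c yc Fc] := orbit_avoid (h y) F finF.
have cF z : z \in s -> z <> c /\ h z <> c.
  move=> zs; split=> zc; apply: Fc; rewrite /F /= mem_cat -zc ?zs//.
  by rewrite map_f ?orbT.
have [sg [Gsg sgy sgc sgF]] := G_swap _ _ _ finF yc.
have Hsg : set_stabilizer G [set` s] sg.
  apply: finite_set_stabilizer => // z zs; rewrite sgF//.
  - by rewrite /F /= mem_cat zs.
  - by move=> zy; rewrite -zy zs in hys.
  - by have [] := cF z zs.
exists (h^-1 * sg * h)%g, y; split=> //.
- apply: is_subgroupM => //; apply: is_subgroupM => //; first exact: is_subgroupV.
  exact: HsubK.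
- rewrite -[X in X \notin _]/((h^-1)%g (sg (h y))) sgy.
  by apply/negP => /cF[_]; rewrite homeoKV.
move=> w ws wy; rewrite -[LHS]/((h^-1)%g (sg (h w))) sgF ?homeoK//.
- by rewrite /F /= mem_cat map_f ?orbT.
- by move/(can_inj (homeo_funK h)) => wyE; rewrite wyE eqxx in wy.
- by have [] := cF w ws.
Qed.

(** Let [t] in [K] move only [y0] out of [Y]. A swap [v] of [y0] and [y], followed by a swap [u] of
    [t y0] and [g y], preserves [Y]; conjugating [t] by [u * v] gives an element of [K] that agrees
    with [g] on [Y]. *)
Lemma overgroup_one_point_moves (g : homeo X) (y : X) :
  G g -> y \in s -> g y \notin s ->
  (forall w, w \in s -> w != y -> g w = w) -> K g.
Proof.
move=> Gg ys gys gid; have [HsubK _] := HK.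
have [t [y0 [Kt y0s ty0s tid]]] := overgroup_moves_one_point.
have [v [Gv vy0 vy vid]] :=
  G_swap _ _ [set` t y0 :: s] (finite_seq _) (s_orbit _ _ y0s ys).
have zz : homeo_orbit G (t y0) (g y).
  apply: (homeo_orbit_trans _ _ G_group _ y0) => //.
    by apply: homeo_orbit_sym => //; exists t => //; exact: KG.
  by apply: homeo_orbit_trans (s_orbit _ _ y0s ys) _ => //; exists g.
have [u [Gu uz ug uid]] := G_swap _ _ [set` s] (finite_seq _) zz.
have us w : w \in s -> u w = w.
  by move=> ws; apply: uid => // wE; move: ws; rewrite wE; exact/negP.
have vs w : w \in s -> v w \in s.
  move=> ws; have [->|/eqP wy0] := eqVneq w y0; first by rewrite vy0.
  have [->|/eqP wy] := eqVneq w y; first by rewrite vy.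
  by rewrite vid//= inE ws orbT.
have vz : v (t y0) = t y0.
  apply: vid; first by rewrite /= inE eqxx.
  - by move=> E; rewrite E y0s in ty0s.
  - by move=> E; rewrite E ys in ty0s.
pose w := (u * v)%g.
have Hw : set_stabilizer G [set` s] w.
  apply: finite_set_stabilizer; first exact: is_subgroupM.
  by move=> x xs; rewrite -[w x]/(u (v x)) us; exact: vs.
have wy0 : w y0 = y by rewrite -[LHS]/(u (v y0)) vy0 us.
have wz : w (t y0) = g y by rewrite -[LHS]/(u (v (t y0))) vz uz.
pose k := (w * t * w^-1)%g.
have Kk : K k.
  by do 2?apply: is_subgroupM => //; [exact: HsubK|apply: is_subgroupV => //; exact: HsubK].
have kg x : x \in s -> k x = g x.
  move=> xs; rewrite -[LHS]/(w (t ((w^-1)%g x))).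
  have [->|xy] := eqVneq x y; first by rewrite -{1}wy0 homeoK.
  rewrite tid ?homeoKV ?gid//.
    have [_ wVs] := is_subgroupV _ _ _ (is_subgroup_set_stabilizer _ _ G_group _) Hw.
    have : [set` s] ((w^-1)%g x) by rewrite -[in X in X _]wVs; exists x.
    by [].
  by apply: contra_neq xy => E; rewrite -wy0 -E homeoKV.
have -> : g = (k * (k^-1 * g))%g by rewrite mulgA mulgV mul1g.
apply: is_subgroupM => //; apply: HsubK; apply: finite_set_stabilizer.
  by apply: is_subgroupM => //; apply: is_subgroupV => //; exact: KG.
by move=> x xs; rewrite -[X in X \in _]/((k^-1)%g (g x)) -kg// homeoK.
Qed.

Lemma overgroup_full : K = G.
Proof.
apply/seteqP; split=> // g.
(* [l] lists the points of [Y] that may still leave [Y]. *)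
have [l gl] : exists l : seq X, forall y, y \in s -> g y \notin s -> y \in l by exists s.
elim: l g gl => [|y0 l IH] g gl Gg.
  have [HsubK _] := HK; apply: HsubK; apply: finite_set_stabilizer => // y ys.
  by apply/negPn/negP => /(gl _ ys).
have [|/not_andP y0s] := pselect (y0 \in s /\ g y0 \notin s); last first.
  apply: IH => // y ys gys; have := gl y ys gys; rewrite inE => /orP[/eqP yE|//].
  by case: y0s; rewrite -yE.
move=> [y0s gy0s].
(* As [g y0] leaves [Y], finiteness forces some [y] in [Y] to be missed by [g]; this is the vacancy
   into which [g y0] is swapped. *)
have [y ys ygs] : exists2 y, y \in s & y \notin map g s.
  apply: contrapT => noy.
  have [] := @finite_set_stabilizer X G s (g^-1)%g (is_subgroupV _ _ _ G_group Gg).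
    move=> y ys; have /mapP[x xs ->] : y \in map g s.
      by apply/negPn/negP => ygs; apply: noy; exists y.
    by rewrite homeoK.
  move=> _ gV; have : [set` s] y0 by [].
  rewrite -gV => -[x /= xs xE].
  by move: gy0s; rewrite -xE homeoKV xs.
have yg : homeo_orbit G y (g y0).
  by apply: homeo_orbit_trans (s_orbit _ _ ys y0s) _ => //; exists g.
have [sg [Gsg sgy sgg sgid]] := G_swap _ _ [set` s ++ map g s] (finite_seq _) yg.
have Ksg : K sg.
  apply: (overgroup_one_point_moves _ y) => //; first by rewrite sgy.
  move=> w ws /eqP wy; apply: sgid => //; first by rewrite /= mem_cat ws.
  by move=> E; rewrite -E ws in gy0s.
have -> : g = (sg^-1 * (sg * g))%g by rewrite mulgA mulVg mul1g.
apply: is_subgroupM => //; first exact: is_subgroupV.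
(* [sg * g] returns [y0] to [Y] and agrees with [g] on the rest of [Y], so [y0] drops off the
   list. *)
apply: IH; last exact: is_subgroupM.
move=> x xs; rewrite -[X in X \notin _]/(sg (g x)).
have [->|xy0] := eqVneq x y0; first by rewrite sgg ys.
rewrite sgid.
- by move=> gxs; have := gl x xs gxs; rewrite inE (negPf xy0).
- by rewrite /= mem_cat map_f ?orbT.
- by move=> E; move: ygs; rewrite -E map_f.
- by move/(can_inj (homeo_funK g)) => E; rewrite E eqxx in xy0.
Qed.

End Overgroup.

Lemma maximal_set_stabilizerP (Y : set X) : finite_set Y -> Y !=set0 ->
  maximal_subgroup G (set_stabilizer G Y) <->
  exists x : X, Y `<=` homeo_orbit G x.
Proof.
move=> finY [y0 Yy0]; split.
  move=> [_ _ noK]; exists y0; apply: contrapT => /existsNP[y2 /not_implyP[Yy2 y02]].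
  apply: noK; pose Y1 := Y `&` homeo_orbit G y0.
  exists (set_stabilizer G Y1); split; first exact: is_subgroup_set_stabilizer.
  (* Elements of [G] preserve orbits, whence the inclusion. It is strict: swapping [y2] with a point
     of its orbit outside [Y] fixes [Y1] but not [Y]. *)
  - split=> [g [Gg gY]|].
      split=> //; apply/seteqP; split=> [_ [y [Yy oy] <-]|y [Yy oy]].
        split; first by rewrite -gY; exists y.
        by apply: homeo_orbit_trans oy _ => //; exists g.
      move: (Yy); rewrite -{1}gY => -[x Yx xy]; exists x => //; split=> //.
      apply: homeo_orbit_trans oy _ => //.
      by apply: homeo_orbit_sym => //; exists g.
    have [c y2c Yc] := orbit_avoid y2 Y finY.
    have [sg [Gsg sgy _ sgid]] := G_swap _ _ _ finY y2c.
    move=> /(_ sg) [].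
      split=> //; apply: image_fixed => y [Yy oy]; apply: sgid => //.
        by move=> E; apply: y02; rewrite -E.
      by move=> E; apply: Yc; rewrite -E.
    by move=> _ sgY; apply: Yc; rewrite -sgY -sgy; exists y2.
  - split=> [g []//|].
    (* The orbit of [y0] is infinite, so some [g] in [G] carries [y0] out of [Y]. *)
    have [_ [g Gg <-] Ygy] := orbit_avoid y0 Y finY.
    move=> /(_ _ Gg) [_ gY1]; apply: Ygy.
    suff [] : Y1 (g y0) by [].
    rewrite -gY1; exists y0 => //; split=> //.
    by exists 1%g => //; exact: is_subgroup1.
move=> [x Yx]; split; first exact: is_subgroup_set_stabilizer.
  split=> [g []//|].
  have [_ [g Gg <-] Ygy] := orbit_avoid y0 Y finY.
  by move=> /(_ _ Gg) [_ gY]; apply: Ygy; rewrite -gY; exists y0.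
move: finY => /finite_seqP[s Ys] [K [K_group HK [KG GK]]].
apply: GK; rewrite Ys in HK Yx; rewrite -(overgroup_full s K)//.
move=> y z ys zs; apply: homeo_orbit_trans (Yx z zs) => //.
by apply: homeo_orbit_sym => //; exact: Yx.
Qed.

End Maximality.

Theorem theorem1p2 (R : realType) (X : topologicalType)
    (X_tot_disc : totally_disconnected [set: X])
    (X_compact : compact [set: X])
    (X_metrizable : metrizable R X)
    (G : set (homeo X))
    (G_group : is_subgroup G)
    (G_ample : ample G)
    (G_orbits : forall x : X, infinite_set (homeo_orbit G x))
    (Y : set X) (Y_finite : finite_set Y) (Y_nonempty : Y !=set0) :
  maximal_subgroup G (set_stabilizer G Y) <->
  exists x : X, Y `<=` homeo_orbit G x.
Proof.
have X_T2 := metrizable_hausdorff _ _ X_metrizable.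
apply: maximal_set_stabilizerP => // x c F; apply: ample_swap => // z W zW.
exact: totally_disconnected_clopen_basis.
Qed.
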